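(* Let $(a_n)_{n\ge0}$ be a sequence of natural numbers with $a_n\ge2$ for all $n$. Let $B$ be the generalized Bratteli diagram with $V_n=\mathbb N=\{1,2,\ldots\}$ for all $n\ge0$ and incidence matrices $F'_n=(f'^{(n)}_{ij})_{i,j\in\mathbb N}$, $n\ge0$, given by $f'^{(n)}_{ii}=a_n$, $f'^{(n)}_{i,i+1}=1$, and $f'^{(n)}_{ij}=0$ for $j\ne i,i+1$. If the series $\sum_{n\ge1}a_n^{-1}$ diverges, then the diagram $B$ does not admit (nonzero) finite tail invariant measures.
   Context: The entry $f'^{(n)}_{ij}$ is the number of edges between vertex $j\in V_n$ (source) and vertex $i\in V_{n+1}$ (range). The path space $X_B$ is the set of infinite paths starting at $V_0$, with topology generated by cylinder sets (sets of infinite paths with a prescribed finite initial path starting in $V_0$). A Borel measure on $X_B$ is tail invariant if it takes equal values on the cylinder sets of any two finite paths starting in $V_0$ with the same terminal vertex. *)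

(* Defs.v *)
From HB Require Import structures.
From mathcomp Require Import all_boot all_order all_algebra.
From mathcomp Require Import all_classical all_reals all_analysis.

Set Implicit Arguments.
Unset Strict Implicit.
Unset Printing Implicit Defensive.

Local Open Scope classical_set_scope.
Local Open Scope card_scope.

(* [V n] is the [n]-th vertex level, [edge n] the set of edges from level [n]
   to level [n.+1]. Countability of both is carried by [countType]. *)
Record generalized_bratteli (V : nat -> countType) := GeneralizedBratteli {
  edge : nat -> countType;
  src : forall n, edge n -> V n;
  rng : forall n, edge n -> V n.+1;
  vert_infinite : forall n, infinite_set [set: V n];
  src_surj : forall n (v : V n), exists e : edge n, src e = v;
  rng_surj : forall n (w : V n.+1), exists e : edge n, rng e = w;
  rng_fin : forall n (w : V n.+1), finite_set [set e : edge n | rng e = w]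
}.

(* [F n i j] counts the edges from the source [j] at level [n] to the range
   [i] at level [n.+1]. *)
Definition has_incidence (V : nat -> countType) (B : generalized_bratteli V)
    (F : forall n, V n.+1 -> V n -> nat) : Prop :=
  forall n (i : V n.+1) (j : V n),
    [set e : edge B n | src e = j /\ rng e = i] #= `I_(F n i j).

Section PathSpace.
Variables (V : nat -> countType) (B : generalized_bratteli V).

Record path_space := PathSpace {
  path_edge :> forall n, edge B n;
  path_edgeP : forall n, rng (path_edge n) = src (path_edge n.+1)
}.

(* Finite paths starting in [V 0], indexed by length and terminal vertex. The
   empty path at [v : V 0] is allowed; its cylinder is the set of infinite
   paths starting at [v], a union of cylinders of paths of length one. *)
Inductive finite_path : forall n, V n -> Type :=
| path_nil (v : V 0) : finite_path v
| path_rcons n (e : edge B n) (p : finite_path (src e)) : finite_path (rng e).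

Fixpoint cylinder n (v : V n) (p : finite_path v) : set path_space :=
  match p with
  | path_nil v0 => [set x | src (x 0) = v0]
  | path_rcons m e q => cylinder q `&` [set x | x m = e]
  end.

Definition cylinders : set (set path_space) :=
  [set C | exists n (v : V n) (p : finite_path v), C = cylinder p].

(* [measurableType] is pointed, so an infinite path is needed; its choice is
   immaterial. *)
Definition some_vertex0 : V 0 :=
  projT1 (cid (infinite_setN0 (@vert_infinite _ B 0))).
Definition out_edge n (v : V n) : edge B n := projT1 (cid (src_surj B v)).
Fixpoint some_vertex n : V n :=
  if n is m.+1 then rng (out_edge (some_vertex m)) else some_vertex0.

Lemma some_pathP n :
  rng (out_edge (some_vertex n)) = src (out_edge (some_vertex n.+1)).
Proof. by rewrite [RHS](projT2 (cid (src_surj B _))). Qed.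

Definition some_path : path_space := PathSpace some_pathP.

HB.instance Definition _ := gen_eqMixin path_space.
HB.instance Definition _ := gen_choiceMixin path_space.
HB.instance Definition _ := isPointed.Build path_space some_path.
HB.instance Definition _ :=
  @isSubBaseTopological.Build path_space (set path_space) cylinders id.

End PathSpace.

Arguments finite_path {V} B {n}.

Definition borel_path_space (V : nat -> countType)
    (B : generalized_bratteli V) :=
  g_sigma_algebraType (@open (path_space B)).

Definition tail_invariant (V : nat -> countType) (B : generalized_bratteli V)
    (R : realType) (mu : set (path_space B) -> \bar R) : Prop :=
  forall n (v : V n) (p q : finite_path B v),
    mu (cylinder p) = mu (cylinder q).

Definition posnat : countType := {i : nat | (0 < i)%N}.

Definition bidiagonal_incidence (a : nat -> nat) (n : nat) (i j : posnat) :
    nat :=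
  if val j == val i then a n else if val j == (val i).+1 then 1 else 0.

(* Main.v *)
Require Import Defs.
From mathcomp Require Import all_boot all_order all_algebra.
From mathcomp Require Import finmap.
From mathcomp Require Import all_classical all_reals all_analysis.
Import numFieldNormedType.Exports.

Set Implicit Arguments.
Unset Strict Implicit.
Unset Printing Implicit Defensive.

(** Let [M n v] be the mass of the infinite paths that pass through the vertex
    [v] of level [n]. Every vertex of level [n.+1] has the same number
    [a n + 1] of incoming edges, so the number of finite paths that end at a
    vertex depends on its level only. Tail invariance then makes all edges into
    one vertex [v] carry the same mass ([through_mass]), namely
    [M n.+1 v / (a n + 1)]. From [v] at level [n], [a n] edges stay at [v] and
    one edge goes down to the vertex [v - 1] (none if [v] is the first vertex).
    So, if [v - 1] carries no mass at any level,
      [M n v <= a n / (a n + 1) * M n.+1 v],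
    that is, [M n v * (1 + 1 / a n) <= M n.+1 v] ([level_mass_step]). The
    products of the factors [1 + 1 / a n] dominate the partial sums of the
    series of the [1 / a n], which diverges, whereas [M] is bounded by the total
    mass; hence [M n v = 0] for all [n] ([bounded_growth_eq0]). Induction on [v]
    gives [M = 0] everywhere ([level_mass_eq0]), and the path space is the
    countable union of the sets of paths that start at a given vertex, so the
    measure is zero. *)

Import Order.TTheory GRing.Theory Num.Theory.

Local Open Scope classical_set_scope.
Local Open Scope ring_scope.

(** * Bounded sequences that grow along a divergent series *)

(** If [u n > 0], iterating the growth condition from [n] on bounds the partial
    sums of [b] beyond [n] by [K / u n], which makes the series converge. *)
Lemma bounded_growth_eq0 (R : realType) (u b : R^nat) (K : R) :
  (forall n, 0 <= b n) -> ~ cvgn (series b) -> (forall n, 0 <= u n <= K) ->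
  (forall n, u n * (1 + b n) <= u n.+1) -> forall n, u n = 0.
Proof.
move=> b0 bdiv uK ustep n; apply: contrapT => /eqP un0; apply: bdiv.
have un_gt0 : 0 < u n by rewrite lt0r un0; case/andP: (uK n).
have grow d : u n * (1 + \sum_(n <= i < n + d) b i) <= u (n + d)%N.
  elim: d => [|d IHd]; first by rewrite addn0 big_geq// addr0 mulr1.
  rewrite addnS big_nat_recr ?leq_addr//=; apply: le_trans (ustep _).
  rewrite addrA mulrDr [leRHS]mulrDr mulr1 lerD// ler_wpM2r//.
  apply: le_trans IHd; apply: ler_peMr; first exact: ltW.
  by rewrite lerDl sumr_ge0.
rewrite -(is_cvg_series_restrict n); apply: nondecreasing_is_cvgn.
  apply/nondecreasing_seqP => N /=; have [nN|Nn] := leqP n N.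
    by rewrite big_nat_recr//= lerDl.
  by rewrite big_geq ?big_geq// ltnW.
exists (K / u n) => _ [N _ <-] /=; rewrite ler_pdivlMr//.
have [nN|Nn] := leqP n N; last first.
  by rewrite big_geq ?mul0r 1?ltnW//; have /andP[u0 /(le_trans u0)] := uK 0%N.
have /andP[_] := uK N; apply: le_trans.
rewrite -(subnKC nN); apply: le_trans (grow _).
by rewrite mulrC ler_wpM2l ?lerDr// ltW.
Qed.

(** * Masses of edges and vertices *)

Section PathMass.
Variables (V : nat -> countType) (B : generalized_bratteli V).

Definition through n (e : edge B n) : set (borel_path_space B) :=
  [set x : path_space B | x n = e].

Definition visit n (v : V n) : set (borel_path_space B) :=
  [set x : path_space B | src (x n) = v].

Lemma prefix_exists n (x : path_space B) :
  exists p : finite_path B (src (x n)), cylinder p x.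
Proof.
elim: n => [|n [p px]]; first by exists (path_nil B (src (x 0%N))).
by rewrite -path_edgeP; exists (path_rcons p).
Qed.

Lemma finite_path_to n (v : V n) : inhabited (finite_path B v).
Proof.
elim: n v => [|n IHn] v; first by constructor; exact: path_nil.
have [e <-] := rng_surj B v; have [p] := IHn (src e).
by constructor; exact: path_rcons.
Qed.

Lemma open_cylinder n (v : V n) (p : finite_path B v) : open (cylinder p).
Proof.
exists [set cylinder p]; last by rewrite bigcup_set1.
by move=> _ ->; apply: finI_from1; exists n, v, p.
Qed.

(** Passing through open sets turns unions of cylinders over the type of finite
    paths, or over a set of edges, into measurable sets at once, whatever the
    size of the index. *)
Lemma open_through n (e : edge B n) :
  open (through e : set (path_space B)).
Proof.
rewrite (_ : through e =
    \bigcup_(p in [set: finite_path B (src e)]) cylinder (path_rcons p)).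
  by apply: bigcup_open => p _; exact: open_cylinder.
apply/seteqP; split=> [x <-|x [p _ [_ //]]].
by have [p px] := prefix_exists n x; exists p.
Qed.

Lemma edge_setE n (S : set (edge B n)) :
  [set x : path_space B | S (x n)] = \bigcup_(e in S) through e.
Proof.
apply/seteqP; split=> [x Sx|x [e Se xe]]; first by exists (x n).
by rewrite /= xe.
Qed.

Lemma measurable_edge_set n (S : set (edge B n)) :
  measurable ([set x : path_space B | S (x n)] : set (borel_path_space B)).
Proof.
apply: sub_sigma_algebra; rewrite edge_setE.
by apply: bigcup_open => e _; exact: open_through.
Qed.

Lemma measurable_through n (e : edge B n) : measurable (through e).
Proof. exact: (measurable_edge_set [set e]). Qed.

Lemma measurable_visit n (v : V n) : measurable (visit v).
Proof. exact: (measurable_edge_set [set e : edge B n | src e = v]). Qed.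

Variable R : realType.
Implicit Type nu : {measure set (borel_path_space B) -> \bar R}.

Lemma edge_set_mass nu n (S : set (edge B n)) (c : \bar R) :
  finite_set S -> (forall e, S e -> nu (through e) = c) ->
  nu [set x : path_space B | S (x n)] = c *+ #|` fset_set S|.
Proof.
move=> Sfin Sc.
rewrite edge_setE measure_fin_bigcup//; last 2 first.
- by move=> e f _ _ [x [<- <-]].
- by move=> e _; exact: measurable_through.
rewrite (eq_fsbigr (fun=> c)); last by move=> e /set_mem; exact: Sc.
rewrite fsbig_finite//= big_const_seq count_predT.
by elim: (size _) => //= k ->; rewrite mulrS.
Qed.

Lemma mrestr_visit_src nu n (e : edge B n) :
  mrestr nu (measurable_through e) (visit (src e)) = nu (through e).
Proof.
rewrite /mrestr; congr (nu _); apply/setIidr => x /= xe.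
by rewrite /visit/= xe.
Qed.

Section EqualRowSums.
Variable k : nat -> nat.
Hypothesis indegree :
  forall n (w : V n.+1), #|` fset_set [set e : edge B n | rng e = w]| = k n.

(** The product counts the finite paths that end at [v]. The measure is
    quantified so that the induction can replace [nu] by its restriction to the
    paths through a last edge [e]: that restriction takes the value [c] on every
    cylinder ending at [src e], with no need to enumerate the finite paths. *)
Lemma visit_mass nu n (v : V n) (c : \bar R) :
  (forall p : finite_path B v, nu (cylinder p) = c) ->
  nu (visit v) = (c *+ \prod_(i < n) k i)%R.
Proof.
elim: n v nu => [|n IHn] v nu nuc.
  by rewrite big_ord0 mulr1n -(nuc (path_nil B v)).
rewrite big_ord_recr/= mulrnA.
rewrite (_ : visit v = [set x : path_space B | rng (x n) = v]); last first.
  by apply/seteqP; split=> x; rewrite /visit/= path_edgeP.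
rewrite (@edge_set_mass _ _ [set e | rng e = v] (c *+ \prod_(i < n) k i)%R).
- by rewrite indegree.
- exact: rng_fin.
move=> e /= ev; subst v.
rewrite -mrestr_visit_src.
apply: (IHn (src e) (mrestr nu (measurable_through e))).
by move=> p; rewrite /= /mrestr; exact: (nuc (path_rcons p)).
Qed.

(** Extending by [e] or by [f] turns equally many finite paths into paths that
    end at the same vertex, whose cylinders all have the same measure. *)
Lemma through_mass nu n (e f : edge B n) :
  tail_invariant nu -> rng e = rng f -> nu (through e) = nu (through f).
Proof.
move=> nuinv ef.
have E (g : edge B n) (p : finite_path B (src g)) : nu (through g) =
    (nu (cylinder (path_rcons p)) *+ \prod_(i < n) k i)%R.
  rewrite -mrestr_visit_src.
  apply: (@visit_mass (mrestr nu (measurable_through g)) n (src g)) => q.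
  by rewrite /= /mrestr; exact: (nuinv _ _ (path_rcons q) (path_rcons p)).
have [p] := finite_path_to (src e); have [q] := finite_path_to (src f).
rewrite (E e p) (E f q); congr (_ *+ _)%R.
by move: (path_rcons p); rewrite ef => p'; exact: nuinv.
Qed.

End EqualRowSums.
End PathMass.

(** * The bidiagonal diagram *)

Section Bidiagonal.
Variables (a : nat -> nat) (B : generalized_bratteli (fun=> posnat)).
Hypothesis hB : has_incidence B (bidiagonal_incidence a).

Lemma bidiagonal_edge n (e : edge B n) :
  val (src e) = val (rng e) \/ val (src e) = (val (rng e)).+1.
Proof.
have := @hB n (rng e) (src e); rewrite /bidiagonal_incidence.
case: eqP => [|_]; first by left.
case: eqP => [|_]; first by right.
by rewrite II0 card_eq0 => /eqP/seteqP[/(_ e) + _]; case.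
Qed.

Lemma loop_count n (v : posnat) :
  #|` fset_set [set e : edge B n | src e = v /\ rng e = v]| = a n.
Proof.
apply: card_fset_set; have := @hB n v v.
by rewrite /bidiagonal_incidence eqxx.
Qed.

Lemma bidiagonal_indegree n (v : posnat) :
  #|` fset_set [set e : edge B n | rng e = v]| = (a n).+1.
Proof.
pose w : posnat := Sub (val v).+1 isT.
have wv : #|` fset_set [set e : edge B n | src e = w /\ rng e = v]| = 1%N.
  apply: card_fset_set; have := @hB n v w.
  by rewrite /bidiagonal_incidence /= eqn_leq ltnn eqxx.
have fin u : finite_set [set e : edge B n | src e = u /\ rng e = v].
  by apply: sub_finite_set (@rng_fin _ B n v) => e [].
rewrite (_ : [set e : edge B n | rng e = v] =
    [set e : edge B n | src e = v /\ rng e = v] `|`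
    [set e : edge B n | src e = w /\ rng e = v]); last first.
  apply/seteqP; split=> [e /= ev|e [[]|[]]//].
  have [E|E] := bidiagonal_edge e; [left|right]; split => //;
    by apply: val_inj; rewrite E ev.
rewrite fset_setU// cardfsU -fset_setI// (_ : _ `&` _ = set0); last first.
  apply/seteqP; split=> // e [[ev _] [ew _]]; move: ew.
  by rewrite ev => /(congr1 val)/= /eqP; rewrite eqn_leq ltnn andbF.
by rewrite fset_set0 cardfs0 subn0 loop_count wv addn1.
Qed.

Variables (R : realType).
Variable mu : {finite_measure set (borel_path_space B) -> \bar R}.
Hypothesis a_gt0 : forall n, (0 < a n)%N.
Hypothesis muinv : tail_invariant mu.

Definition level_mass n (v : posnat) : R := fine (mu (@visit _ B n v)).

Lemma level_mass_ge0 n v : 0 <= level_mass n v.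
Proof. exact: fine_ge0. Qed.

Lemma level_massE n v : mu (@visit _ B n v) = (level_mass n v)%:E.
Proof. by rewrite fineK// fin_num_measure//; exact: measurable_visit. Qed.

Lemma level_mass_le n v : level_mass n v <= fine (mu setT).
Proof.
apply: fine_le; rewrite ?fin_num_measure//; first exact: measurable_visit.
by apply: le_measure; rewrite ?inE//; exact: measurable_visit.
Qed.

(** Almost every path through [v] at level [n] uses one of the [a n] loops at
    [v], and these are [a n] of the [(a n).+1] edges of equal mass that make up
    the paths through [v] at level [n.+1]. *)
Lemma level_mass_step n (v : posnat) :
  (forall u : posnat, (val u).+1 = val v -> level_mass n.+1 u = 0) ->
  level_mass n v * (1 + (a n)%:R^-1) <= level_mass n.+1 v.
Proof.
move=> lower0.
pose loop := [set x : path_space B | src (x n) = v /\ rng (x n) = v]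
  : set (borel_path_space B).
pose fall := [set x : path_space B |
  src (x n) = v /\ (val (rng (x n))).+1 = val v] : set (borel_path_space B).
have mloop : measurable loop.
  exact: (measurable_edge_set [set e : edge B n | src e = v /\ rng e = v]).
have mfall : measurable fall.
  exact: (measurable_edge_set
    [set e : edge B n | src e = v /\ (val (rng e)).+1 = val v]).
have fall0 : mu fall = 0%E.
  (* A falling path provides the vertex below v, and all of them pass there. *)
  have [->|/set0P[x [xv xu]]] := eqVneq fall set0; first by rewrite measure0.
  apply: (@subset_measure0 _ _ _ mu _ (@visit _ B n.+1 (rng (x n)))) => //.
  - exact: measurable_visit.
  - move=> y [_ yu]; rewrite /visit /= -path_edgeP; apply: val_inj.
    by apply: succn_inj; rewrite yu xu.
  - by rewrite [LHS]level_massE lower0.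
have [e0 e0v] := rng_surj B (v : (fun=> posnat) n.+1).
have edge_mass (e : edge B n) : rng e = v -> mu (through e) = mu (through e0).
  move=> ev; apply: (@through_mass _ B R _ bidiagonal_indegree mu n e e0) => //.
  by rewrite ev.
have fin : finite_set [set e : edge B n | rng e = v] := rng_fin B v.
have mu_loop : mu loop = (mu (through e0) *+ a n)%R.
  rewrite (@edge_set_mass _ _ _ mu _
    [set e | src e = v /\ rng e = v] (mu (through e0))) ?loop_count//.
    by apply: sub_finite_set fin => e [].
  by move=> e [_ /edge_mass].
have mu_visit : mu (@visit _ B n.+1 v) = (mu (through e0) *+ (a n).+1)%R.
  rewrite -(bidiagonal_indegree n v).
  rewrite -(@edge_set_mass _ _ _ mu _ [set e | rng e = v])//.
  by congr (mu _); apply/seteqP; split=> x; rewrite /visit/= path_edgeP.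
have : (mu (@visit _ B n v) <= mu loop)%E.
  rewrite -[leRHS]adde0 -fall0; apply: le_trans (measureU2 _ mloop mfall).
  apply: le_measure; rewrite ?inE//; [exact: measurable_visit|exact: measurableU|].
  move=> x xv; have [E|E] := bidiagonal_edge (x n); [left|right]; split => //.
    by rewrite -xv; apply: val_inj.
  by rewrite -xv -E.
move: mu_loop mu_visit; rewrite !level_massE => -> .
have /fineK <- : mu (through e0) \is a fin_num.
  by apply: fin_num_measure; exact: measurable_through.
set r := fine _.
rewrite -[(_ *+ (a n).+1)%R]EFin_natmul -[(_ *+ a n)%R]EFin_natmul.
rewrite lee_fin => -[->] le_loop.
have an0 : 0 < (a n)%:R :> R by rewrite ltr0n.
apply: (@le_trans _ _ ((r *+ a n) * (1 + (a n)%:R^-1))).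
  by rewrite ler_wpM2r// addr_ge0// invr_ge0 ltW.
rewrite -[r *+ a n]mulr_natr -mulrA mulrDr mulr1 divff ?gt_eqF//.
by rewrite natr1 mulr_natr.
Qed.

(** Strong induction on the vertex covers the first one as well, since no vertex
    lies below it. *)
Lemma level_mass_eq0 (hdiv : ~ cvgn (series (fun n => (a n)%:R^-1 : R))) n v :
  level_mass n v = 0.
Proof.
move: {2}(val v) (erefl (val v)) => m; elim/ltn_ind: m n v => m IHm n v vm.
apply: (@bounded_growth_eq0 _ (level_mass^~ v)
  (fun k => (a k)%:R^-1) (fine (mu setT))) => //.
- by move=> k; rewrite level_mass_ge0 level_mass_le.
- move=> k; apply: level_mass_step => u uv; apply: IHm (erefl (val u)).
  by rewrite -vm -uv.
Qed.

End Bidiagonal.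

Theorem proposition7p8 (R : realType) (a : nat -> nat)
    (ha : forall n, (2 <= a n)%N)
    (B : generalized_bratteli (fun=> posnat))
    (hB : has_incidence B (bidiagonal_incidence a))
    (hdiv : ~ cvgn (fun N : nat => \sum_(1 <= n < N.+1) (a n)%:R^-1 : R)) :
  ~ exists mu : {finite_measure set (borel_path_space B) -> \bar R},
      tail_invariant mu /\
      exists2 A : set (borel_path_space B), measurable A & mu A <> 0%E.
Proof.
move=> [mu [muinv [A mA]]]; apply.
have div : ~ cvgn (series (fun n => (a n)%:R^-1 : R)).
  move=> cv; apply: hdiv.
  have : cvgn (fun N : nat => \sum_(1 <= n < N) (a n)%:R^-1 : R).
    by rewrite (is_cvg_series_restrict 1).
  by move=> /cvg_ex[l]; rewrite -cvg_shiftS => cl; apply/cvg_ex; exists l.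
apply/eqP; rewrite -measure_le0.
pose start (k : nat) : set (borel_path_space B) :=
  if choice.unpickle k is Some v then @visit _ B 0%N v else set0.
have start0 k : mu (start k) = 0.
  rewrite /start; case: choice.unpickle => [v|]; last by rewrite measure0.
  by rewrite [LHS]level_massE (level_mass_eq0 hB)// => m; exact: ltnW (ha m).
have mstart k : measurable (start k).
  rewrite /start; case: choice.unpickle => [v|] //; exact: measurable_visit.
apply: (@le_trans _ _ (\sum_(0 <= k <oo) mu (start k))%E); last first.
  by rewrite eseries0// => k _ _; exact: start0.
apply: measure_sigma_subadditive => // x Ax.
exists (choice.pickle (src (x 0%N : edge B 0))) => //.
by rewrite /start choice.pickleK.
Qed.
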